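(* Let $(\alpha_n)$ and $(\beta_n)$ be sequences of positive numbers converging to zero and, for each $n$, let $\mathbb{P}_n'$ be a $\beta_n$-locally perturbed data distribution. Let $\mathcal{Z}$ be an open and bounded subset of $\mathbb{R}^d$. Let $C_{\mathrm{H}}, C_{\nabla}, L>0$, $k\in(0,1]$, and $M\ge\sup_{n\in\mathbb{N}}\beta_n$ be constants. Assume that $\mathcal{H}$ is a uniformly bounded set of differentiable functions $h:\mathrm{Conv}(\mathcal{Z})+\mathcal{B}(M)\to\mathbb{R}$ such that, for every $h\in\mathcal{H}$, the gradient $\nabla_z h$ is $(C_{\mathrm{H}},k)$-Hölder continuous, $\mathbb{E}_{\mathrm{data}}(\|\nabla_z h\|_* )\ge C_{\nabla}$, and $\mathrm{Lip}(h)\le L$. For $p\in(1+k,\infty)$, let $\hat h^{\mathrm{prop}}_{(\alpha_n,\beta_n),p}$ denote a minimizer over $h\in\mathcal{H}$ of $$R^{\mathrm{prop}}_{(\alpha_n,\beta_n),p}(\mathbb{P}_n,h)=R(\mathbb{P}_n',h)+\alpha_n\|\nabla_z h\|_{\mathbb{P}_n',p^*}.$$ Then $$\mathcal{E}(\hat h^{\mathrm{prop}}_{(\alpha_n,\beta_n),p})=O_p\left(\mathfrak{R}_n(\mathcal{H})\vee n^{-1/2}\vee\alpha_n\vee\log(n)\,(\alpha_n^{1+k}\vee\beta_n)\right).$$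
   Context: $\|\cdot\|$ is a norm on $\mathbb{R}^d\supseteq\mathcal{Z}$ and $\|\cdot\|_*$ its dual norm; $a\vee b=\max(a,b)$. $\mathbb{P}_{\mathrm{data}}$ is the true data distribution, a Borel probability measure on $\mathcal{Z}$; $z_1,\dots,z_n$ are i.i.d. samples from $\mathbb{P}_{\mathrm{data}}$, and $\mathbb{P}_n=\frac1n\sum_{i=1}^n\delta_{z_i}$. $\mathbb{E}_{\mathrm{data}}$ denotes expectation under $\mathbb{P}_{\mathrm{data}}$ (for functions of several samples, under i.i.d. draws from it). $R(\mathbb{Q},h)=\int h\,d\mathbb{Q}$. The excess risk of $g\in\mathcal{H}$ is $\mathcal{E}(g)=R(\mathbb{P}_{\mathrm{data}},g)-\inf_{h\in\mathcal{H}}R(\mathbb{P}_{\mathrm{data}},h)$. For the dataset $\{z_1,\dots,z_n\}$ and $\beta\ge0$, $\mathbb{P}_n'$ is a $\beta$-locally perturbed data distribution if $\mathbb{P}_n'=\frac1n\sum_{i=1}^n\delta_{z_i'}$ for some $z_1',\dots,z_n'$ with $z_i'=z_i+e_i$ and $\|e_i\|\le\beta$ for all $i\in\{1,\dots,n\}$. The Rademacher complexity is $\mathfrak{R}_n(\mathcal{H})=\mathbb{E}_{\mathrm{data}}\mathbb{E}_\sigma\big(\frac1n\sup_{h\in\mathcal{H}}|\sum_{i=1}^n\sigma_i h(Z_i)|\big)$, where $Z_1,\dots,Z_n$ are i.i.d. from $\mathbb{P}_{\mathrm{data}}$ and $\sigma_1,\dots,\sigma_n$ are independent random variables taking values $\pm1$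 with probability $1/2$ each. $\mathrm{Conv}(\mathcal{Z})$ is the convex hull of $\mathcal{Z}$, and $S+\mathcal{B}(M)=\{z+r: z\in S,\ \|r\|\le M\}$. $\mathrm{Lip}(h)$ is the smallest Lipschitz constant of $h$ with respect to $\|\cdot\|$. A function $g$ from a set $D\subseteq\mathbb{R}^d$ to $\mathbb{R}^d$ is $(C_{\mathrm{H}},k)$-Hölder continuous if $\|g(z)-g(\tilde z)\|_*\le C_{\mathrm{H}}\|z-\tilde z\|^k$ for all $z,\tilde z\in D$. For $r\in[1,\infty)$ and a probability measure $\mathbb{Q}$, $\|g\|_{\mathbb{Q},r}=(\int\|g(z)\|_*^r\,d\mathbb{Q}(z))^{1/r}$. $p^*=(1-1/p)^{-1}$. For a random sequence $(B_n)$ and positive constants $(a_n)$, $B_n=O_p(a_n)$ means: for every $\varepsilon>0$ there exist constants $C,n_0$ such that $P(|B_n|>Ca_n)<\varepsilon$ for all $n\ge n_0$. *)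

(* Defs.v *)
From HB Require Import structures.
From mathcomp Require Import all_boot all_order all_algebra finmap.
From mathcomp Require Import all_classical all_reals all_analysis.

Set Implicit Arguments.
Unset Strict Implicit.
Unset Printing Implicit Defensive.

Import Order.TTheory GRing.Theory Num.Theory.
Import numFieldNormedType.Exports.

Local Open Scope classical_set_scope.
Local Open Scope ring_scope.

(* A copy of R^d carrying the Borel sigma-algebra of its usual topology (all
   norms on R^d induce that topology). *)
Definition borel_rV (R : realType) (d : nat) :=
  g_sigma_algebraType (@open 'rV[R]_d).

Section Geometry.
Context {R : realType} {d : nat}.
Implicit Types (N : 'rV[R]_d -> R) (D S : set 'rV[R]_d) (h : 'rV[R]_d -> R).

(* Nonnegativity and N 0 = 0 follow from these three axioms. *)
Definition is_norm N : Prop :=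
  [/\ forall x, N x = 0 -> x = 0,
      forall (a : R) x, N (a *: x) = `|a| * N x
    & forall x y, N (x + y) <= N x + N y].

Definition dual_norm N (g : 'rV[R]_d) : R :=
  sup [set \sum_(i < d) g 0 i * z 0 i | z in [set z | N z <= 1]].

Definition grad h (z : 'rV[R]_d) : 'rV[R]_d :=
  \row_(i < d) 'D_(delta_mx 0 i) h z.

Definition convex_hull S : set 'rV[R]_d :=
  [set x | exists m (w : 'I_m -> R) (y : 'I_m -> 'rV[R]_d),
     [/\ forall i, 0 <= w i, \sum_(i < m) w i = 1,
         forall i, S (y i) & x = \sum_(i < m) w i *: y i]].

Definition enlarge N S (M : R) : set 'rV[R]_d :=
  [set z + r | z in S & r in [set r | N r <= M]].

(* The library's Lipschitz predicate is tied to the canonical (sup) norm of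
   'rV[R]_d, hence this version for N. The value is +oo when h is not
   Lipschitz on D. *)
Definition Lip N D h : \bar R :=
  ereal_inf [set l%:E | l in [set l : R | 0 <= l /\
    forall x y, D x -> D y -> `|h x - h y| <= l * N (x - y)]].

Definition holder N D (C k : R) (g : 'rV[R]_d -> 'rV[R]_d) : Prop :=
  forall x y, D x -> D y ->
    dual_norm N (g x - g y) <= C * (N (x - y) `^ k).

End Geometry.

(* A function with domain D is represented by a total function on R^d, of which
   only the values on D are ever used: integrals against measures carried by D
   are taken over D. *)
Section Risk.
Context {R : realType} {d : nat}.
Implicit Types (N : 'rV[R]_d -> R) (D : set 'rV[R]_d)
  (h : 'rV[R]_d -> R) (H : set ('rV[R]_d -> R))
  (Q : {measure set (borel_rV R d) -> \bar R}).

Definition risk D Q h : R := \int[Q]_(x in (D : set (borel_rV R d))) h x.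

Definition excess_risk D Q H (g : 'rV[R]_d -> R) : R :=
  risk D Q g - inf [set risk D Q h | h in H].

Definition norm_Lr N D Q (r : R) (g : 'rV[R]_d -> 'rV[R]_d) : R :=
  (\int[Q]_(x in (D : set (borel_rV R d))) (dual_norm N (g x) `^ r)) `^ r^-1.

(* The empirical distribution of y 0, ..., y (n - 1). *)
Definition empirical n (y : nat -> borel_rV R d) :
    {measure set (borel_rV R d) -> \bar R} :=
  mscale (n%:R^-1)%:nng (msum (fun i => \d_(y i)) n).

(* Equality of measures is equality on Borel sets. *)
Definition locally_perturbed N n (z : nat -> 'rV[R]_d) (b : R) Q : Prop :=
  exists e : nat -> 'rV[R]_d,
    (forall i, (i < n)%N -> N (e i) <= b) /\
    (forall A, measurable A -> Q A = empirical n (fun i => z i + e i) A).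

Definition prop_objective N D Q (a p : R) h : R :=
  risk D Q h + a * norm_Lr N D Q (1 - p^-1)^-1 (grad h).

Definition is_minimizer (F : ('rV[R]_d -> R) -> R) H (g : 'rV[R]_d -> R) :
    Prop :=
  H g /\ forall h, H h -> F g <= F h.

End Risk.

Section Probability.
Context {dO : measure_display} {Omega : measurableType dO} {R : realType}.
Variable P : probability Omega R.

Definition mutually_independent dT (T : measurableType dT)
    (X : nat -> Omega -> T) : Prop :=
  forall (J : {fset nat}) (A : nat -> set T), (forall i, measurable (A i)) ->
    P (\bigcap_(i in [set` J]) (X i @^-1` A i)) =
    (\prod_(i <- J) P (X i @^-1` A i))%E.

Definition iid dT (T : measurableType dT) (Q : probability T R)
    (X : nat -> Omega -> T) : Prop :=
  [/\ forall i, measurable_fun setT (X i),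
      forall i A, measurable A -> P (X i @^-1` A) = Q A
    & mutually_independent X].

(* B n need not be measurable (it may come from an arbitrary choice of
   minimizers), so that the probability of its upper tails is the outer measure
   of P, which coincides with P on measurable sets. *)
Definition bigOp (B : nat -> Omega -> R) (a : nat -> R) : Prop :=
  forall eps : R, 0 < eps -> exists (C : R) (n0 : nat), forall n, (n0 <= n)%N ->
    (mu_ext P [set w | (C * a n < `|B n w|)%R] < eps%:E)%E.

(* X is meant to be an i.i.d. sequence from the data distribution, on whose law
   only the value depends. The expectation over the n independent uniform signs
   is the average over the 2 ^ n sign vectors, the i-th sign being
   (-1) ^+ s i. *)
Definition rademacher d (X : nat -> Omega -> 'rV[R]_d)
    (H : set ('rV[R]_d -> R)) (n : nat) : R :=
  \int[P]_w ((2 ^+ n)^-1 * \sum_(s : {ffun 'I_n -> bool})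
    (n%:R^-1 * sup [set `|\sum_(i < n) (-1) ^+ s i * h (X i w)| | h in H])).

End Probability.

(* Main.v *)
(* Let [K = L + 1], so that every [h] in [H] is [K]-Lipschitz on [D] and
   [0 <= dual_norm N (grad h x) <= K] there. Replacing the perturbed points by
   the sample costs at most [K * beta n] and the penalty lies between [0] and
   [K * alpha n], so the excess risk is at most
   [2 * sup_h |P_n h - P h| + K * alpha n + 2 * K * beta n]. By symmetrization
   the expectation of the supremum is at most twice the Rademacher complexity,
   and Markov's inequality concludes.

   To avoid measurability questions about suprema and product measures, the
   points are first rounded to a finite grid of mesh [beta n]: the rounded
   sample takes finitely many values, with product weights by independence, so
   symmetrization is a statement about finite sums, and rounding only costs
   further multiples of [K * beta n]. *)

Require Import Defs.
From HB Require Import structures.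
From mathcomp Require Import all_boot all_order all_algebra finmap.
From mathcomp Require Import all_classical all_reals all_analysis.
From mathcomp Require Import measurable_realfun ring lra.

Set Implicit Arguments.
Unset Strict Implicit.
Unset Printing Implicit Defensive.

Import Order.TTheory GRing.Theory Num.Theory.
Import numFieldNormedType.Exports.

Local Open Scope classical_set_scope.
Local Open Scope ring_scope.

(** * Suprema of absolute values over a class *)

Section SupNorm.
Context {R : realType} {U : Type}.
Implicit Types (H : set U) (F : U -> R).

Definition sup_abs H F : R := sup [set `|F h| | h in H].

(** The bound [C] makes the supremum a genuine one: [sup] takes a default value on sets that are not
    bounded above. *)
Lemma le_sup_abs H F C h : (forall h, H h -> `|F h| <= C) -> H h ->
  `|F h| <= sup_abs H F.
Proof.
move=> FC Hh; apply: ub_le_sup; last by exists h.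
by exists C => _ [g Hg <-]; exact: FC.
Qed.

Lemma sup_abs_le H F C : H !=set0 -> (forall h, H h -> `|F h| <= C) ->
  sup_abs H F <= C.
Proof.
move=> [h Hh] FC; apply: ge_sup; first by exists `|F h|, h.
by move=> _ [g Hg <-]; exact: FC.
Qed.

Lemma sup_abs_ge0 H F C : H !=set0 -> (forall h, H h -> `|F h| <= C) ->
  0 <= sup_abs H F.
Proof.
by move=> [h Hh] FC; exact: le_trans (normr_ge0 _) (le_sup_abs FC Hh).
Qed.

End SupNorm.

(** * Symmetrization for samples from a finite set *)

Section Symmetrization.
Context {R : realType} {T : finType} (p : T -> R) (n : nat).
Hypotheses (p_ge0 : forall t, 0 <= p t) (p_sum1 : \sum_t p t = 1).
Implicit Types (f g : {ffun 'I_n -> T}) (s : {ffun 'I_n -> bool}).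

(** The law of [n] independent draws from [p]. *)
Definition prod_weight f : R := \prod_i p (f i).

Lemma prod_weight_ge0 f : 0 <= prod_weight f.
Proof. exact: prodr_ge0. Qed.

Lemma sum_prod_weight : \sum_f prod_weight f = 1.
Proof. by rewrite -(bigA_distr_bigA (fun=> p)) big1. Qed.

(** Written as a product over coordinates with factor 1 away from [i], the sum factorizes, and every
    coordinate other than [i] contributes the total mass 1. *)
Lemma sum_prod_weight_marginal (u : T -> R) (i : 'I_n) :
  \sum_f prod_weight f * u (f i) = \sum_t p t * u t.
Proof.
transitivity (\sum_(f : {ffun 'I_n -> T})
    \prod_j (p (f j) * (if j == i then u (f j) else 1))).
  apply: eq_bigr => f _; rewrite big_split/=; congr (_ * _).
  by rewrite (bigD1 i)//= eqxx big1 ?mulr1// => j /negbTE ->.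
rewrite -(bigA_distr_bigA (fun j t => p t * (if j == i then u t else 1))).
rewrite (bigD1 i)//= [X in _ * X]big1 ?mulr1; last first.
  by move=> j /negbTE ->; under eq_bigr do rewrite mulr1.
by apply: eq_bigr => t _; rewrite eqxx.
Qed.

(* Exchanging the [i]-th points of two independent samples whenever [s i] holds
   preserves their joint weight and flips the [i]-th sign of their difference. *)
Let swap s (fg : {ffun 'I_n -> T} * {ffun 'I_n -> T}) :=
  ([ffun i => if s i then fg.2 i else fg.1 i],
   [ffun i => if s i then fg.1 i else fg.2 i]).

Let swapK s : involutive (swap s).
Proof.
by move=> [f g]; congr pair; apply/ffunP => i; rewrite !ffunE/=; case: (s i).
Qed.

Let prod_weight_swap s fg :
  prod_weight (swap s fg).1 * prod_weight (swap s fg).2 =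
  prod_weight fg.1 * prod_weight fg.2.
Proof.
rewrite /prod_weight -!big_split/=; apply: eq_bigr => i _.
by rewrite !ffunE; case: (s i) => //; rewrite mulrC.
Qed.

Variables (H : set (T -> R)) (B : R).
Hypotheses (H_neq0 : H !=set0) (H_le : forall h, H h -> forall t, `|h t| <= B).

(** This is [n] times the largest deviation, over the class, of the mean over the sample [f] from
    the expectation under [p]. *)
Definition centered_sup f : R :=
  sup_abs H (fun h => \sum_i (h (f i) - \sum_t p t * h t)).

Definition signed_sup s f : R :=
  sup_abs H (fun h => \sum_i (-1) ^+ s i * h (f i)).

(** The sample [g] is an independent ghost copy of [f]; the constantly false [s] gives the unsigned
    difference. *)
Let diff_sup s f g : R :=
  sup_abs H (fun h => \sum_i (-1) ^+ s i * (h (f i) - h (g i))).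

Lemma signed_sum_le s f h : H h ->
  `|\sum_i (-1) ^+ s i * h (f i)| <= n%:R * B.
Proof.
move=> Hh; apply: le_trans (ler_norm_sum _ _ _) _.
apply: (@le_trans _ _ (\sum_(i < n) B)); last first.
  by rewrite sumr_const card_ord mulr_natl.
by apply: ler_sum => i _; rewrite normrM normrX normrN1 expr1n mul1r H_le.
Qed.

Let diff_sum_le s f g h : H h ->
  `|\sum_i (-1) ^+ s i * (h (f i) - h (g i))| <=
  `|\sum_i (-1) ^+ s i * h (f i)| + `|\sum_i (-1) ^+ s i * h (g i)|.
Proof.
move=> Hh; under eq_bigr do rewrite mulrBr.
by rewrite sumrB ler_normB.
Qed.

Let diff_bound s f g h : H h ->
  `|\sum_i (-1) ^+ s i * (h (f i) - h (g i))| <= n%:R * B + n%:R * B.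
Proof.
move=> Hh; apply: le_trans (diff_sum_le s f g Hh) _.
by rewrite lerD// signed_sum_le.
Qed.

Let diff_sup_le s f g : diff_sup s f g <= signed_sup s f + signed_sup s g.
Proof.
apply: sup_abs_le => // h Hh; apply: le_trans (diff_sum_le s f g Hh) _.
by apply: lerD; apply: (le_sup_abs _ Hh) => h' Hh'; exact: signed_sum_le.
Qed.

(** Jensen's inequality: the expectation under [p] is an average over ghost samples [g], and the
    supremum of an average is at most the average of the suprema. *)
Let centered_le f : centered_sup f <=
  \sum_g prod_weight g * diff_sup [ffun=> false] f g.
Proof.
apply: sup_abs_le => // h Hh.
have -> : \sum_i (h (f i) - \sum_t p t * h t) =
    \sum_g prod_weight g * \sum_i (h (f i) - h (g i)).
  under [RHS]eq_bigr do rewrite mulr_sumr.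
  rewrite exchange_big/=; apply: eq_bigr => i _.
  under [RHS]eq_bigr do rewrite mulrBr.
  by rewrite sumrB -mulr_suml sum_prod_weight mul1r sum_prod_weight_marginal.
apply: le_trans (ler_norm_sum _ _ _) _; apply: ler_sum => g _.
rewrite normrM ger0_norm ?prod_weight_ge0// ler_wpM2l ?prod_weight_ge0//.
have -> : \sum_i (h (f i) - h (g i)) =
    \sum_i (-1) ^+ [ffun=> false] i * (h (f i) - h (g i)).
  by apply: eq_bigr => i _; rewrite ffunE mul1r.
apply: (le_sup_abs (F := fun h : T -> R =>
  \sum_i (-1) ^+ [ffun=> false] i * (h (f i) - h (g i))) _ Hh) => h' Hh'.
exact: diff_bound.
Qed.

Let diff_sup_swap s f g :
  diff_sup [ffun=> false] (swap s (f, g)).1 (swap s (f, g)).2 = diff_sup s f g.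
Proof.
congr sup_abs; apply/funext => h; apply: eq_bigr => i _.
by rewrite !ffunE/=; case: (s i); rewrite ?mul1r//= expr1 mulN1r opprB.
Qed.

(** Reindexing the double sum by the swap brings in the signs [s]. The triangle inequality then
    separates the two samples, and in each half the weights of the other sample sum to 1. *)
Let centered_le_signed s :
  \sum_f prod_weight f * centered_sup f <=
  2 * \sum_f prod_weight f * signed_sup s f.
Proof.
apply: (@le_trans _ _ (\sum_f \sum_g prod_weight f * prod_weight g *
    diff_sup [ffun=> false] f g)).
  apply: ler_sum => f _.
  apply: (@le_trans _ _ (prod_weight f *
      \sum_g prod_weight g * diff_sup [ffun=> false] f g)).
    by rewrite ler_wpM2l ?prod_weight_ge0.
  by rewrite mulr_sumr ler_sum// => g _; rewrite mulrA.
rewrite pair_big/= (reindex_inj (inv_inj (swapK s)))/=.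
apply: (@le_trans _ _ (\sum_(fg : {ffun 'I_n -> T} * {ffun 'I_n -> T})
    prod_weight fg.1 * prod_weight fg.2 *
    (signed_sup s fg.1 + signed_sup s fg.2))).
  apply: ler_sum => -[f g] _.
  rewrite (prod_weight_swap s (f, g)) (diff_sup_swap s f g) ler_wpM2l//.
  by rewrite mulr_ge0 ?prod_weight_ge0.
rewrite -(pair_big xpredT xpredT (fun f g => prod_weight f * prod_weight g *
    (signed_sup s f + signed_sup s g)))/=.
under eq_bigr do under eq_bigr do rewrite mulrDr.
under eq_bigr do rewrite big_split/=.
rewrite big_split/= [X in _ + X]exchange_big/= mulr2n mulrDl mul1r.
apply: lerD; apply: ler_sum => f _.
  under eq_bigr do rewrite mulrAC.
  by rewrite -mulr_sumr sum_prod_weight mulr1.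
under eq_bigr do rewrite -mulrA.
by rewrite -mulr_suml sum_prod_weight mul1r.
Qed.

(** The bound holds for each fixed sign vector, hence for the average over all [2 ^ n] of them. *)
Lemma symmetrization :
  \sum_f prod_weight f * centered_sup f <=
  2 * \sum_f prod_weight f * ((2 ^+ n)^-1 * \sum_s signed_sup s f).
Proof.
have n0 : (2 : R) ^+ n != 0 by rewrite expf_neq0.
rewrite -[leLHS](mulKf n0) ler_pdivrMl ?exprn_gt0//.
rewrite mulrCA [leRHS](_ : _ =
    \sum_s (2 * \sum_f prod_weight f * signed_sup s f)); last first.
  rewrite -mulr_sumr exchange_big/= mulr_sumr; congr (_ * _).
  by apply: eq_bigr => f _; rewrite mulrCA (mulVKf n0) mulr_sumr.
rewrite (_ : 2 ^+ n = #|{ffun 'I_n -> bool}|%:R); last first.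
  by rewrite card_ffun card_bool card_ord natrX.
rewrite mulr_natl -sumr_const; apply: ler_sum => s _; exact: centered_le_signed.
Qed.

End Symmetrization.

(** * Continuity of affine maps *)

Section AffineContinuity.
Context {R : realType} {V : normedModType R}.

Lemma affine_continuous (a b : V) (c : R) :
  continuous (fun u => a + c *: (u - b)).
Proof.
move=> u; apply: cvgD; first exact: cvg_cst.
by apply: cvgZ; [exact: cvg_cst|apply: cvgB; [exact: cvg_id|exact: cvg_cst]].
Qed.

Lemma line_continuous (v x : V) : continuous (fun t : R => t *: v + x).
Proof.
move=> t; apply: cvgD; last exact: cvg_cst.
by apply: cvgZ; [exact: cvg_id|exact: cvg_cst].
Qed.

End AffineContinuity.

(** * Norms, enlarged convex hulls and gradients of Lipschitz functions *)

Section Geometry.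
Context {R : realType} {d : nat} (N : 'rV[R]_d -> R) (hN : is_norm N).
Implicit Types (x y v : 'rV[R]_d) (h : 'rV[R]_d -> R) (D : set 'rV[R]_d).

Lemma is_norm0 : N 0 = 0.
Proof. by have [_ NZ _] := hN; rewrite -(scale0r 0) NZ normr0 mul0r. Qed.

Lemma is_normN x : N (- x) = N x.
Proof. by have [_ NZ _] := hN; rewrite -scaleN1r NZ normrN1 mul1r. Qed.

Lemma is_norm_ge0 x : 0 <= N x.
Proof.
have [_ _ ND] := hN; have := ND x (- x).
by rewrite subrr is_norm0 is_normN -mulr2n pmulrn_lge0.
Qed.

(** Expansion in the canonical basis compares [N] with the sup norm; this turns coordinatewise
    rounding errors into errors for [N]. *)
Lemma is_norm_le_entries x (a : R) : (forall i, `|x 0 i| <= a) ->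
  N x <= a * \sum_(i < d) N (delta_mx 0 i).
Proof.
have [_ NZ ND] := hN; move=> xa; rewrite {1}(row_sum_delta x) mulr_sumr.
elim/big_ind2 : _ => [|u a1 v a2 ua va|i _]; first by rewrite is_norm0.
  by apply: le_trans (ND _ _) _; exact: lerD.
by rewrite NZ ler_wpM2r ?is_norm_ge0.
Qed.

Lemma enlarge_hull (Z : set 'rV[R]_d) (M : R) x e : Z x -> N e <= M ->
  enlarge N (convex_hull Z) M (x + e).
Proof.
move=> Zx eM; exists x; last by exists e.
exists 1%N, (fun=> 1), (fun=> x); split => //.
- by rewrite big_ord1.
- by rewrite big_ord1 scale1r.
Qed.

(** Openness makes the domain Borel and leaves room around each of its points for difference
    quotients. *)
Lemma open_enlarge_hull (Z : set 'rV[R]_d) (M : R) : open Z ->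
  open (enlarge N (convex_hull Z) M).
Proof.
move=> Zo; rewrite openE => _ [_ [m [w [y [w0 w1 Zy ->]]]] [r rM <-]].
have [j wj] : exists j, w j != 0.
  apply/existsP; rewrite -[X in is_true X]negbK; apply/negP => /existsPn w_eq0.
  move: w1; rewrite big1 => [/esym/eqP|i _]; first by rewrite oner_eq0.
  by apply/eqP; rewrite -[_ == _]negbK; exact: w_eq0.
set x0 : 'rV[R]_d := _ + r.
(* Moving the single point [y j], whose weight is nonzero, already sweeps out a
   neighborhood of [x0]. *)
pose moved (u : 'rV[R]_d) : 'rV[R]_d := y j + (w j)^-1 *: (u - x0).
have moved_cont : continuous moved.
  exact: affine_continuous.
have moved_x0 : moved x0 = y j by rewrite /moved subrr scaler0 addr0.
have near_Z : nbhs x0 (moved @^-1` Z).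
  apply: moved_cont; apply: open_nbhs_nbhs; split => //.
  by rewrite moved_x0; exact: Zy.
rewrite /interior; apply: filterS near_Z => u /= Zu.
exists (\sum_(i < m) w i *: (if i == j then moved u else y i)).
  exists m, w, (fun i => if i == j then moved u else y i).
  by split => // i; case: ifP.
exists r => //; rewrite (bigD1 j)//= eqxx /moved scalerDr scalerA mulfV//.
rewrite scale1r.
rewrite (eq_bigr (fun i => w i *: y i)); last by move=> i /negbTE ->.
rewrite [in u - _]/x0 [in u - _](bigD1 j)//= [X in X + r]addrAC.
by rewrite [LHS]addrAC; exact: subrKC.
Qed.

(** An infimum at most [L] has a Lipschitz constant below [L + 1], whether or not it is attained. *)
Lemma Lip_le_succ D h (L : R) : (Lip N D h <= L%:E)%E ->
  forall x y, D x -> D y -> `|h x - h y| <= (L + 1) * N (x - y).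
Proof.
move=> hL x y Dx Dy.
have /ereal_inf_lt[_ [l [l0 hl] <-]] : (Lip N D h < (L + 1)%:E)%E.
  by rewrite (le_lt_trans hL)// lte_fin ltrDl.
rewrite lte_fin => lL; apply: le_trans (hl _ _ Dx Dy) _.
by rewrite ler_wpM2r ?is_norm_ge0 ?(ltW lL).
Qed.

Section Lipschitz.
Variables (D : set 'rV[R]_d) (h : 'rV[R]_d -> R) (K : R).
Hypotheses (D_open : open D) (K_ge0 : 0 <= K).
Hypothesis h_lip : forall x y, D x -> D y -> `|h x - h y| <= K * N (x - y).
Hypothesis h_diff : forall x, D x -> differentiable h x.

Lemma derive_lip_le x v : D x -> `|'D_v h x| <= K * N v.
Proof.
move=> Dx; have [_ NZ _] := hN.
have hv : derivable h x v by exact: diff_derivable (h_diff Dx).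
have cv : `|t^-1 *: ((h \o shift x) (t *: v) - h x)| @[t --> (0:R)^'] -->
    `|'D_v h x| by exact: cvg_norm hv.
rewrite -(cvg_lim _ cv)//; apply: limr_le.
  by apply/cvg_ex; eexists; exact: cv.
have xv : (t *: v + x) @[t --> (0 : R)] --> x.
  have := @line_continuous R _ v x 0.
  by rewrite /continuous_at scale0r add0r.
have Dn : \forall t \near (0 : R)^', D (t *: v + x).
  by apply: cvg_within; apply: xv; exact: open_nbhs_nbhs.
near=> t.
have t0 : t != 0 by near: t; exact: nbhs_dnbhs_neq.
rewrite normrZ normfV ler_pdivrMl ?normr_gt0//=.
apply: le_trans (h_lip _ Dx) _; first by near: t.
by rewrite addrK NZ mulrCA.
Unshelve. all: by end_near. Qed.

Let grad_dotE x v : D x -> \sum_(i < d) grad h x 0 i * v 0 i = 'D_v h x.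
Proof.
move=> Dx; rewrite (deriveE _ (h_diff Dx)) {2}(row_sum_delta v) linear_sum/=.
apply: eq_bigr => i _; rewrite linearZ/= mxE -deriveE; last exact: h_diff.
by rewrite mulrC.
Qed.

Let grad_dot_le x v : D x -> N v <= 1 ->
  \sum_(i < d) grad h x 0 i * v 0 i <= K.
Proof.
move=> Dx Nv; rewrite grad_dotE//; apply: le_trans (ler_norm _) _.
by apply: le_trans (derive_lip_le _ Dx) _; rewrite ler_piMr.
Qed.

(** The value at the zero vector gives both the nonemptiness behind the upper bound on [dual_norm]
    and its nonnegativity. *)
Let grad_dot0 x : [set \sum_(i < d) grad h x 0 i * v 0 i |
  v in [set v | N v <= 1]] 0.
Proof.
exists 0 => /=; first by rewrite is_norm0.
by rewrite big1// => i _; rewrite [X in _ * X]mxE mulr0.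
Qed.

Lemma dual_norm_grad_le x : D x -> dual_norm N (grad h x) <= K.
Proof.
move=> Dx; apply: ge_sup; first by exists 0; exact: grad_dot0.
by move=> _ [v /= Nv <-]; exact: grad_dot_le.
Qed.

Lemma dual_norm_grad_ge0 x : D x -> 0 <= dual_norm N (grad h x).
Proof.
move=> Dx; apply: ub_le_sup; last exact: grad_dot0.
by exists K => _ [v /= Nv <-]; exact: grad_dot_le.
Qed.

End Lipschitz.
End Geometry.

(** * Integrals of functions of a finitely valued map *)

Section FiniteValued.
Context {d : measure_display} {X : measurableType d} {R : realType}.
Context {T : finType} (phi : X -> T).
Hypothesis mphi : forall t, measurable [set x | phi x = t].

Lemma measurable_finite_valued (A : set T) : measurable (phi @^-1` A).
Proof.
rewrite (_ : phi @^-1` A = \bigcup_(t in A) [set x | phi x = t]).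
  by apply: fin_bigcup_measurable => //; exact: finite_finset.
by apply/seteqP; split=> [x Ax|x [t At] /= xt]; [exists (phi x)|rewrite xt].
Qed.

Lemma measurable_fun_finite_valued (D : set X) (g : T -> R) :
  measurable D -> measurable_fun D (g \o phi).
Proof.
move=> mD _ Y _; rewrite comp_preimage.
by apply: measurableI => //; exact: measurable_finite_valued.
Qed.

Lemma integrable_finite_valued (mu : probability X R)
    (D : set X) (g : T -> R) :
  measurable D -> mu.-integrable D (EFin \o (g \o phi)).
Proof.
move=> mD; apply: measurable_bounded_integrable => //.
- by rewrite ltey_eq fin_num_measure.
- exact: measurable_fun_finite_valued.
- exists (\sum_t `|g t|); split; first exact: num_real.
  move=> b /ltW gb x _ /=; apply: le_trans gb.
  by rewrite (bigD1 (phi x))//= lerDl sumr_ge0.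
Qed.

Lemma integral_finite_valued (mu : probability X R)
    (D : set X) (g : T -> R) : measurable D ->
  \int[mu]_(x in D) g (phi x) =
  \sum_t fine (mu (D `&` [set x | phi x = t])) * g t.
Proof.
move=> mD; rewrite /Rintegral.
have gE x : (g (phi x))%:E =
    (\sum_t (g t)%:E * (\1_[set x | phi x = t] x)%:E)%E.
  rewrite (bigD1 (phi x))//= indicE mem_set// mule1 big1 ?adde0// => t.
  rewrite eq_sym => /eqP xt.
  by rewrite indicE memNset// mule0.
under eq_integral do rewrite gE.
have int_indic t : mu.-integrable D
    (fun x => (\1_[set x | phi x = t] x)%:E).
  by apply: integrableS (integrable_indic mu (mphi t)).
rewrite integral_sum//; last by move=> t; exact: integrableZl.
rewrite (eq_bigr (fun t => (fine (mu (D `&` [set x | phi x = t])) * g t)%:E)).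
  by rewrite sumEFin.
move=> t _; rewrite integralZl// integral_indic// setIC mulrC EFinM fineK//.
by rewrite fin_num_measure//; exact: measurableI.
Qed.

End FiniteValued.

(** * Integral comparisons without measurability *)

Section Integration.
Context {d : measure_display} {X : measurableType d} {R : realType}.
Variable mu : {measure set X -> \bar R}.

(** The integral of a nonnegative function is a supremum over the simple functions below it, and a
    larger function has more of them below it. *)
Lemma ge0_le_integral_nonmeas (D : set X) (f g : X -> \bar R) :
  (forall x, D x -> 0 <= f x)%E -> (forall x, D x -> f x <= g x)%E ->
  (\int[mu]_(x in D) f x <= \int[mu]_(x in D) g x)%E.
Proof.
move=> f0 fg; have g0 x : D x -> (0 <= g x)%E.
  by move=> Dx; exact: le_trans (f0 _ Dx) (fg _ Dx).
rewrite !ge0_integralE//; apply: ereal_sup_le => _ [u /= uf <-].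
exists u => // x; apply: le_trans (uf x) _.
by rewrite /patch; case: ifPn => // /set_mem; exact: fg.
Qed.

(** Finiteness lets inequalities pass to real-valued integrals, since [fine] sends infinite values
    to 0. *)
Let fin_num_integral (D : set X) (f : X -> R) (c : R) :
  measurable D -> (mu D <= 1)%E -> 0 <= c -> (forall x, D x -> 0 <= f x <= c) ->
  (\int[mu]_(x in D) (f x)%:E <= c%:E)%E /\
  (\int[mu]_(x in D) (f x)%:E)%E \is a fin_num.
Proof.
move=> mD muD c0 fc; have f0 x : D x -> 0 <= f x by case/fc/andP.
have intc : (\int[mu]_(x in D) (f x)%:E <= c%:E)%E.
  apply: (@le_trans _ _ (\int[mu]_(x in D) c%:E)%E).
    by apply: ge0_le_integral_nonmeas => x Dx;
      rewrite lee_fin ?f0//; case/andP: (fc _ Dx).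
  by rewrite integral_cst// -[leRHS]mule1 lee_wpmul2l.
split=> //; rewrite ge0_fin_numE; first exact: le_lt_trans intc (ltry _).
by apply: integral_ge0 => x Dx; rewrite lee_fin f0.
Qed.

Lemma Rintegral_le_cst (D : set X) (f : X -> R) (c : R) :
  measurable D -> (mu D <= 1)%E -> 0 <= c -> (forall x, D x -> 0 <= f x <= c) ->
  \int[mu]_(x in D) f x <= c.
Proof.
move=> mD muD c0 fc; have [intc fin_int] := fin_num_integral mD muD c0 fc.
by rewrite -lee_fin fineK.
Qed.

Lemma le_Rintegral_nonmeas (D : set X) (f g : X -> R) (c : R) :
  measurable D -> (mu D <= 1)%E ->
  (forall x, D x -> 0 <= f x) -> (forall x, D x -> f x <= g x) ->
  0 <= c -> (forall x, D x -> g x <= c) ->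
  \int[mu]_(x in D) f x <= \int[mu]_(x in D) g x.
Proof.
move=> mD muD f0 fg c0 gc.
have [|_ finf] := @fin_num_integral D f c mD muD c0.
  by move=> x Dx; rewrite f0//= (le_trans (fg _ Dx)) ?gc.
have [|_ fing] := @fin_num_integral D g c mD muD c0.
  by move=> x Dx; rewrite (le_trans (f0 _ Dx)) ?fg ?gc.
rewrite -lee_fin !fineK//.
by apply: ge0_le_integral_nonmeas => x Dx; rewrite lee_fin ?f0 ?fg.
Qed.

End Integration.

(** * Borel sets and rounding to a finite grid *)

Section Borel.
Context {R : realType} {d : nat}.

Lemma open_borel (A : set 'rV[R]_d) :
  open A -> measurable (A : set (borel_rV R d)).
Proof. by move=> oA; apply: sub_sigma_algebra. Qed.

Lemma continuous_borel (D : set 'rV[R]_d) (h : 'rV[R]_d -> R) :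
  open D -> {in D, continuous h} ->
  measurable_fun (D : set (borel_rV R d)) (h : borel_rV R d -> R).
Proof.
move=> oD /(continuous_inP h oD) ch.
apply: (measurability _ (RGenOpens.measurableE R)).
move=> _ [_ [a [b ->] <-]]; apply: open_borel; apply: ch.
exact: interval_open.
Qed.

(** The first threshold strictly above [a] exceeds it by at most [eta], so it does not pass [b]; its
    index is controlled because [a <= A]. *)
Lemma threshold_between (A eta a b : R) :
  0 < eta -> - A <= a <= A -> a + eta < b ->
  exists2 l, (l < (Num.trunc (2 * A / eta)).+3)%N & a < - A + l%:R * eta <= b.
Proof.
move=> eta_gt0 /andP[Aa aA] ab; exists (Num.trunc ((a + A) / eta)).+1.
  rewrite !ltnS; apply: leq_trans (leqnSn _).
  rewrite truncn_le_nat; apply: le_lt_trans (truncnS_gt _).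
  by rewrite ler_pM2r ?invr_gt0//; lra.
have : 0 <= (a + A) / eta by apply: divr_ge0; [lra|exact: ltW].
move=> /truncn_itv /andP[]; set l := Num.trunc _.
rewrite ler_pdivlMr// ltr_pdivrMr//.
have -> : l.+1%:R * eta = l%:R * eta + eta by rewrite -natr1 mulrDl mul1r.
by move=> ? ?; apply/andP; split; lra.
Qed.

(* The label of a point records on which side of finitely many equally spaced
   thresholds each of its coordinates lies; points of a bounded set with the
   same label are close. *)
Lemma discretization (N : 'rV[R]_d -> R) (hN : is_norm N) (Z : set 'rV[R]_d)
    (x0 : 'rV[R]_d) (delta : R) : bounded_set Z -> Z x0 -> 0 < delta ->
  exists (T : finType) (label : borel_rV R d -> T) (rep : T -> 'rV[R]_d),
    [/\ forall t, measurable [set x | label x = t], forall t, Z (rep t)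
      & forall x, Z x -> N (x - rep (label x)) <= delta].
Proof.
move=> [A0 [_ hA]] Zx0 delta0.
have [A [A_gt0 ZA]] : exists A : R,
    0 < A /\ forall x, Z x -> forall i, `|x 0 i| <= A.
  exists (`|A0| + 1); split; first by rewrite ltr_wpDl.
  move=> x Zx i; apply: le_trans (hA _ _ x Zx); last first.
    by rewrite (le_lt_trans (ler_norm _))// ltrDl.
  rewrite [leRHS]/Num.norm/= mx_normrE.
  exact: (@le_bigmax _ _ _ _ (fun ij => `|x ij.1 ij.2|) (0, i)).
set S := \sum_(i < d) N (delta_mx 0 i).
have S_ge0 : 0 <= S by apply: sumr_ge0 => i _; exact: is_norm_ge0.
(* Coordinates within [eta] put points within [eta * S <= delta] for [N]; the added 1 keeps the
   denominator positive when [S] is 0. *)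
pose eta := delta / (S + 1).
have eta_gt0 : 0 < eta by rewrite divr_gt0 ?ltr_wpDl.
pose m := (Num.trunc (2 * A / eta)).+3.
pose th (l : 'I_m) : R := - A + l%:R * eta.
pose label (x : borel_rV R d) : {ffun 'I_d * 'I_m -> bool} :=
  [ffun q => (x : 'rV[R]_d) 0 q.1 < th q.2].
(* A label met by no point of [Z] gets the default [x0], which also lies in [Z]. *)
pose rep t := xget x0 (Z `&` [set x | label x = t]).
have Zrep t : Z (rep t) by rewrite /rep; case: xgetP => [y _ []|].
exists _, label, rep; split=> // [t|x Zx].
  rewrite (_ : [set x | label x = t] = \bigcap_(q in [set: 'I_d * 'I_m])
      [set x : borel_rV R d | ((x : 'rV[R]_d) 0 q.1 < th q.2) = t q]);
    last first.
    apply/seteqP; split=> [x /= <- q _|x xt]; first by rewrite ffunE.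
    by apply/ffunP => q; rewrite ffunE; exact: xt.
  apply: fin_bigcap_measurable => [|q _]; first exact: finite_finset.
  have m1 : measurable
      [set x : borel_rV R d | (x : 'rV[R]_d) 0 q.1 < th q.2].
    apply: open_borel; rewrite (_ : [set x | _] =
      (fun x : 'rV[R]_d => x 0 q.1) @^-1` [set y | y < th q.2])//.
    apply: open_comp; last exact: open_lt.
    by move=> x _; exact: coord_continuous.
  case: (t q) => //.
  rewrite (_ : [set x | _] =
    ~` [set x : borel_rV R d | (x : 'rV[R]_d) 0 q.1 < th q.2]).
    exact: measurableC.
  by apply/seteqP; split=> y /=; [move/negbT/negP|move/negP/negbTE].
have labr : label (rep (label x)) = label x.
  by apply: (@xgetPex _ x0 (Z `&` [set y | label y = label x]) _).2; exists x.
have Zr := Zrep (label x).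
set y := rep (label x) in Zr labr *.
(* A coordinate gap larger than [eta] would contain a threshold, and the labels would differ
   there. *)
have key (u v : 'rV[R]_d) : Z u -> Z v -> label u = label v ->
    forall i, v 0 i - u 0 i <= eta.
  move=> Zu Zv uv i; rewrite leNgt; apply/negP; rewrite ltrBrDl => uv_gt.
  have uA : - A <= u 0 i <= A by rewrite -ler_norml ZA.
  have [l lm /andP[ul lv]] := threshold_between eta_gt0 uA uv_gt.
  have := congr1 (fun g : {ffun 'I_d * 'I_m -> bool} => g (i, Ordinal lm)) uv.
  by rewrite !ffunE /th/= ul ltNge lv.
apply: (@le_trans _ _ (eta * S)).
  apply: is_norm_le_entries => // i; rewrite !mxE ler_norml lerNl opprB.
  by rewrite !key.
rewrite /eta mulrAC ler_pdivrMr ?ltr_wpDl// ler_pM2l//.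
by rewrite lerDl.
Qed.

End Borel.

Section IidLabels.
Context {dO : measure_display} {Omega : measurableType dO} {R : realType}.
Variable P : probability Omega R.
Context {dX : measure_display} {X : measurableType dX} (Q : probability X R).
Variables (z : nat -> Omega -> X).
Hypothesis z_iid : iid P Q z.
Context {T : finType} (label : X -> T).
Hypothesis mlabel : forall t, measurable [set x | label x = t].

Definition label_prob (t : T) : R := fine (Q [set x | label x = t]).

Definition sample_labels n (w : Omega) : {ffun 'I_n -> T} :=
  [ffun i : 'I_n => label (z i w)].

Let z_label_measurable i t : measurable (z i @^-1` [set x | label x = t]).
Proof.
by have [mz _ _] := z_iid; rewrite -[X in measurable X]setTI; exact: mz.
Qed.

Lemma sample_labelsE n (f : {ffun 'I_n -> T}) :
  [set w | sample_labels n w = f] =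
  \bigcap_(i in [set: 'I_n]) z i @^-1` [set x | label x = f i].
Proof.
apply/seteqP; split=> [w /= <- i _/=|w wf]; first by rewrite ffunE.
by apply/ffunP => i; rewrite ffunE; exact: wf.
Qed.

Lemma measurable_sample_labels n (f : {ffun 'I_n -> T}) :
  measurable [set w | sample_labels n w = f].
Proof.
by rewrite sample_labelsE; apply: fin_bigcap_measurable.
Qed.

Lemma label_prob_ge0 t : 0 <= label_prob t.
Proof. by apply: fine_ge0. Qed.

Lemma sum_label_prob : \sum_t label_prob t = 1.
Proof.
have := integral_finite_valued mlabel Q (fun=> 1) measurableT.
rewrite Rintegral_cst// mul1r [fine _](_ : _ = 1) => [->|].
  by apply: eq_bigr => t _; rewrite setTI mulr1.
by rewrite -[RHS]/(fine 1%E); congr fine; exact: probability_setT.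
Qed.

Lemma sample_labels_prob n (f : {ffun 'I_n -> T}) :
  P [set w | sample_labels n w = f] = (prod_weight label_prob f)%:E.
Proof.
have [mz zQ z_indep] := z_iid.
pose A i :=
  if insub i is Some j then [set x | label x = f (j : 'I_n)] else setT.
have mA i : measurable (A i) by rewrite /A; case: insub.
have AE (i : 'I_n) : A i = [set x | label x = f i].
  by rewrite /A (valK i).
have [J [memJ permJ]] : exists J : {fset nat},
    (forall i, (i \in J) = (i < n)%N) /\ perm_eq J (iota 0 n).
  exists (seq_fset tt (iota 0 n)); split=> [i|].
    by rewrite seq_fsetE mem_iota add0n.
  by rewrite -[X in perm_eq _ X]undup_id ?iota_uniq// seq_fset_perm.
have := z_indep J A mA; rewrite (perm_big _ permJ).
rewrite (_ : (\prod_(i <- iota 0 n) _)%E =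
    (\prod_(i < n) P (z i @^-1` A i))%E); last first.
  by rewrite -(big_mkord xpredT (fun i => P (z i @^-1` A i))) /index_iota subn0.
rewrite (eq_bigr (fun i : 'I_n => (label_prob (f i))%:E)); last first.
  by move=> i _; rewrite zQ// AE /label_prob fineK// fin_num_measure.
rewrite prodEFin => <-; congr (P _); rewrite sample_labelsE.
apply/seteqP; split=> [w wA i|w wA i _].
  rewrite /= memJ => i_lt.
  have AEi : A i = [set x | label x = f (Ordinal i_lt)] := AE (Ordinal i_lt).
  by rewrite /preimage AEi; exact: (wA (Ordinal i_lt) I).
by rewrite -AE; apply: wA; rewrite /= memJ ltn_ord.
Qed.

Lemma integral_sample_labels n (G : {ffun 'I_n -> T} -> R) :
  \int[P]_w G (sample_labels n w) = \sum_f prod_weight label_prob f * G f.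
Proof.
rewrite (integral_finite_valued (@measurable_sample_labels n))//.
by apply: eq_bigr => f _; rewrite setTI sample_labels_prob.
Qed.

Lemma sample_labels_markov n (G : {ffun 'I_n -> T} -> R) (a : R) :
  (forall f, 0 <= G f) -> 0 < a ->
  (P [set w | (a < G (sample_labels n w))%R] <=
   ((\sum_f prod_weight label_prob f * G f) / a)%:E)%E.
Proof.
move=> G0 a0; pose E := [set w | a < G (sample_labels n w)].
have mE : measurable E.
  exact: (measurable_finite_valued (@measurable_sample_labels n)
    [set f | a < G f]).
have PE : fine (P E) = \sum_f prod_weight label_prob f * (a < G f)%R%:R.
  rewrite -(integral_sample_labels (fun f => (a < G f)%R%:R)) /Rintegral.
  rewrite -[in LHS](setIT E) -integral_indic//; congr fine.
  apply: eq_integral => w _; rewrite indicE; congr (_%:R%:E); congr nat_of_bool.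
  by apply/idP/idP => [/set_mem//|aG]; exact/mem_set.
rewrite -/E -[leLHS]fineK ?fin_num_measure// lee_fin PE ler_pdivlMr// mulr_suml.
apply: ler_sum => f _; rewrite -mulrA ler_wpM2l//.
  by apply: prod_weight_ge0 => t; exact: label_prob_ge0.
by case: ltP => [/ltW|]; rewrite ?mul1r ?mul0r.
Qed.

End IidLabels.

Section Risk.
Context {R : realType} {d : nat}.
Implicit Types (D Z : set 'rV[R]_d) (h : 'rV[R]_d -> R) (B c : R).

Lemma empirical_full n (y : nat -> borel_rV R d) D :
  (0 < n)%N -> (forall i, (i < n)%N -> D (y i)) -> empirical n y D = 1%E.
Proof.
move=> n0 Dy.
rewrite -[LHS]/((n%:R^-1)%:E * \sum_(i < n) \d_(y i) D)%E.
rewrite (eq_bigr (fun=> 1%E)); last first.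
  by move=> i _; rewrite diracE mem_set//; exact: Dy.
rewrite sumEFin sumr_const card_ord -EFinM mulVf//.
by rewrite pnatr_eq0 -lt0n.
Qed.

Let integrable_bounded (mu : {measure set (borel_rV R d) -> \bar R}) D h B :
  measurable (D : set (borel_rV R d)) -> (mu D < +oo)%E ->
  measurable_fun (D : set (borel_rV R d)) (h : borel_rV R d -> R) ->
  (forall x, D x -> `|h x| <= B) ->
  mu.-integrable (D : set (borel_rV R d)) (EFin \o (h : borel_rV R d -> R)).
Proof.
move=> mD muD mh hB; apply: measurable_bounded_integrable => //.
exists B; split; first exact: num_real.
by move=> b /ltW Bb x Dx /=; exact: le_trans (hB x Dx) Bb.
Qed.

Lemma risk_empirical (Q : {measure set (borel_rV R d) -> \bar R}) n y D h B :
  (0 < n)%N -> (forall i, (i < n)%N -> D (y i)) ->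
  (forall A, measurable A -> Q A = empirical n y A) ->
  measurable (D : set (borel_rV R d)) ->
  measurable_fun (D : set (borel_rV R d)) (h : borel_rV R d -> R) ->
  (forall x, D x -> `|h x| <= B) ->
  risk D Q h = n%:R^-1 * \sum_(i < n) h (y i).
Proof.
move=> n0 Dy QE mD mh hB.
pose f (x : borel_rV R d) := h x + B.
have mf : measurable_fun (D : set (borel_rV R d)) f by exact: measurable_funD.
have f0 x : D x -> 0 <= f x.
  by move=> /hB; rewrite ler_norml /f => /andP[+ _]; rewrite -lerBlDr sub0r.
have nR0 : n%:R != 0 :> R by rewrite pnatr_eq0 -lt0n.
have empD : empirical n y D = 1%E by exact: empirical_full.
have int_f : \int[empirical n y]_(x in (D : set (borel_rV R d))) f x =
    n%:R^-1 * \sum_(i < n) f (y i).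
  rewrite /Rintegral ge0_integral_mscale//; last first.
    exact/measurable_EFinP.
  rewrite ge0_integral_measure_sum//; last exact/measurable_EFinP.
  rewrite (eq_bigr (fun i : 'I_n => (f (y i))%:E)); last first.
    move=> i _; rewrite integral_dirac//; last exact/measurable_EFinP.
    by rewrite diracE mem_set ?mul1e//; exact: Dy.
  by rewrite sumEFin.
rewrite /risk /Rintegral.
rewrite (@eq_measure_integral _ _ _ _ (empirical n y)); last first.
  by move=> A mA _; exact: QE.
rewrite -/(Rintegral _ _ _).
rewrite (@eq_Rintegral _ _ _ _ _ (fun x => f x - B)); last first.
  by move=> x _; rewrite /f addrK.
have inth := integrable_bounded mD _ mh hB.
rewrite RintegralB//; last 2 first.
- apply: (@integrable_bounded _ D _ (B + B)) => //; first by rewrite empD ltry.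
  move=> x Dx; rewrite ger0_norm ?f0// lerD2r.
  exact: le_trans (ler_norm _) (hB _ Dx).
- apply: (@integrable_bounded _ D _ `|B|) => //; first by rewrite empD ltry.
rewrite int_f Rintegral_cst// empD mulr1 big_split/= sumr_const card_ord mulrDr.
by rewrite -[B *+ n]mulr_natl mulKf// addrK.
Qed.

(* Only the values on [Z] matter to a probability carried by [Z], and there
   [h] is close to its discretization. *)
Lemma risk_label_prob (Q : probability (borel_rV R d) R) D Z h B c
    (T : finType) (label : borel_rV R d -> T) (rep : T -> 'rV[R]_d) :
  Q (Z : set (borel_rV R d)) = 1%E ->
  measurable (D : set (borel_rV R d)) -> measurable (Z : set (borel_rV R d)) ->
  Z `<=` D -> 0 <= c ->
  (forall t, measurable [set x | label x = t]) ->
  measurable_fun (D : set (borel_rV R d)) (h : borel_rV R d -> R) ->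
  (forall x, D x -> `|h x| <= B) ->
  (forall x, Z x -> `|h x - h (rep (label x))| <= c) ->
  `|risk D Q h - \sum_t label_prob Q label t * h (rep t)| <= c.
Proof.
move=> QZ mD mZ ZD c0 mlabel mh hB hc.
have QnZ (A : set (borel_rV R d)) : measurable A -> Q (A `\` Z) = 0%E.
  move=> mA; apply/eqP; rewrite eq_le measure_ge0 andbT.
  apply: (@le_trans _ _ (Q (~` Z))).
    by apply: le_measure => [||x []//]; rewrite inE;
      [exact: measurableD|exact: measurableC].
  by rewrite probability_setC// QZ subee.
have QI (A : set (borel_rV R d)) : measurable A -> Q (Z `&` A) = Q A.
  move=> mA; have -> : Q A = (Q (A `\` Z) + Q (A `&` Z))%E by exact: measureDI.
  by rewrite QnZ// add0e setIC.
have finD (A : set (borel_rV R d)) : measurable A -> (Q A < +oo)%E.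
  by move=> mA; rewrite ltey_eq fin_num_measure.
have int_h : Q.-integrable (D : set (borel_rV R d))
    (EFin \o (h : borel_rV R d -> R)).
  exact: integrable_bounded (finD _ mD) mh hB.
have int_hZ : Q.-integrable (Z : set (borel_rV R d))
    (EFin \o (h : borel_rV R d -> R)).
  exact: integrableS int_h.
have -> : risk D Q h = \int[Q]_(x in (Z : set (borel_rV R d))) h x.
  rewrite /risk /Rintegral (negligible_integral (measurableD mD mZ))//;
    last exact: QnZ.
  by rewrite setDD setIidr.
have int_g := integrable_finite_valued mlabel Q (h \o rep) mZ.
have -> : \sum_t label_prob Q label t * h (rep t) =
    \int[Q]_(x in (Z : set (borel_rV R d))) (h \o rep) (label x).
  rewrite (integral_finite_valued mlabel Q (h \o rep) mZ).
  by apply: eq_bigr => t _; rewrite QI.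
rewrite -RintegralB//; apply: le_trans (le_normr_Rintegral _ _) _ => //.
  exact: (integrableB mZ int_hZ int_g).
apply: Rintegral_le_cst => //; first exact: probability_le1.
by move=> x Zx; rewrite normr_ge0 hc.
Qed.

End Risk.

Section Deterministic.
Context {R : realType} {d : nat}.

Lemma norm_Lr_le (N : 'rV[R]_d -> R) (D : set 'rV[R]_d)
    (Q : {measure set (borel_rV R d) -> \bar R}) (r K : R)
    (g : 'rV[R]_d -> 'rV[R]_d) :
  measurable (D : set (borel_rV R d)) ->
  (Q (D : set (borel_rV R d)) <= 1)%E -> 0 < r -> 0 <= K ->
  (forall x, D x -> 0 <= dual_norm N (g x) <= K) ->
  0 <= norm_Lr N D Q r g <= K.
Proof.
move=> mD QD r0 K0 gK; rewrite powR_ge0/=.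
have -> : K = (K `^ r) `^ r^-1 by rewrite -powRrM mulfV ?gt_eqF// powRr1.
apply: ge0_ler_powR; rewrite ?invr_ge0 ?nnegrE ?powR_ge0 ?(ltW r0)//.
  by apply: Rintegral_ge0 => x _; exact: powR_ge0.
apply: Rintegral_le_cst; rewrite ?powR_ge0// => x Dx; rewrite powR_ge0/=.
by have /andP[? ?] := gK _ Dx; apply: ge0_ler_powR; rewrite ?nnegrE ?(ltW r0).
Qed.

Lemma excess_risk_bound (N : 'rV[R]_d -> R) (D : set 'rV[R]_d)
    (Pdata Q : {measure set (borel_rV R d) -> \bar R})
    (H : set ('rV[R]_d -> R)) (a p K eta : R) (g : 'rV[R]_d -> R) :
  0 <= a -> is_minimizer (prop_objective N D Q a p) H g ->
  (forall h, H h -> `|risk D Q h - risk D Pdata h| <= eta) ->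
  (forall h, H h -> 0 <= norm_Lr N D Q (1 - p^-1)^-1 (grad h) <= K) ->
  `|excess_risk D Pdata H g| <= 2 * eta + a * K.
Proof.
move=> a0 [Hg g_min] eta_le normK.
have lower h : H h -> risk D Pdata g - (2 * eta + a * K) <= risk D Pdata h.
  move=> Hh; have := g_min h Hh; rewrite /prop_objective.
  have := eta_le _ Hh; have := eta_le _ Hg; have := normK _ Hg.
  have := normK _ Hh; rewrite !ler_norml.
  move: (norm_Lr _ _ _ _ (grad h)) (norm_Lr _ _ _ _ (grad g)) => nh ng.
  move: (risk D Q g) (risk D Q h) => q1 q2.
  move: (risk D Pdata g) (risk D Pdata h) => r1 r2.
  move=> /andP[_ nhK] /andP[ng0 _] /andP[? ?] /andP[? ?] ?.
  have := ler_wpM2l a0 nhK; have := mulr_ge0 a0 ng0 => ? ?.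
  by lra.
have inf_lb : lbound [set risk D Pdata h | h in H]
    (risk D Pdata g - (2 * eta + a * K)).
  by move=> _ [h Hh <-]; exact: lower.
have inf_le : inf [set risk D Pdata h | h in H] <= risk D Pdata g.
  by apply: ge_inf; [exists (risk D Pdata g - (2 * eta + a * K))|exists g].
rewrite /excess_risk ger0_norm ?subr_ge0// lerBlDr -lerBlDl.
by apply: lb_le_inf => //; exists (risk D Pdata g), g.
Qed.

End Deterministic.

Section Deviation.
Context {R : realType} {d : nat} {dO : measure_display}
  {Omega : measurableType dO} (P : probability Omega R)
  (Pdata : probability (borel_rV R d) R) (z : nat -> Omega -> borel_rV R d)
  (z_iid : iid P Pdata z).
Variables (Z : set 'rV[R]_d) (H : set ('rV[R]_d -> R)) (B c : R).
Hypotheses (z_in : forall i w, Z (z i w)) (c_ge0 : 0 <= c) (H_neq0 : H !=set0).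
Hypothesis H_le : forall h, H h -> forall x, Z x -> `|h x| <= B.
Context {T : finType} (label : borel_rV R d -> T) (rep : T -> 'rV[R]_d).
Hypothesis mlabel : forall t, measurable [set x | label x = t].
Hypothesis Z_rep : forall t, Z (rep t).
Hypothesis H_rep : forall h, H h -> forall x, Z x ->
  `|h x - h (rep (label x))| <= c.

Definition discretized : set (T -> R) := [set h \o rep | h in H].

Lemma discretized_neq0 : discretized !=set0.
Proof. by have [h Hh] := H_neq0; exists (h \o rep), h. Qed.

Lemma discretized_le h : discretized h -> forall t, `|h t| <= B.
Proof. by move=> [g Hg <-] t; exact: H_le. Qed.

Let p := label_prob Pdata label.

Let p_ge0 t : 0 <= p t. Proof. exact: label_prob_ge0. Qed.
Let p_sum1 : \sum_t p t = 1. Proof. exact: sum_label_prob. Qed.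

Lemma centered_sup_ub n (f : {ffun 'I_n -> T}) h : discretized h ->
  `|\sum_i (h (f i) - \sum_t p t * h t)| <= centered_sup p discretized f.
Proof.
apply: (@le_sup_abs _ _ _ _ (\sum_(i < n) (B + B))) => {}h Hh.
apply: le_trans (ler_norm_sum _ _ _) _; apply: ler_sum => i _.
apply: le_trans (ler_normB _ _) _; rewrite lerD ?(discretized_le Hh)//.
apply: le_trans (ler_norm_sum _ _ _) _.
rewrite -[leRHS]mul1r -p_sum1 mulr_suml; apply: ler_sum => t _.
by rewrite normrM ger0_norm// ler_wpM2l// (discretized_le Hh).
Qed.

Lemma centered_sup_ge0 n (f : {ffun 'I_n -> T}) :
  0 <= centered_sup p discretized f.
Proof.
have [h Hh] := discretized_neq0.
exact: le_trans (normr_ge0 _) (centered_sup_ub f Hh).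
Qed.

Lemma empirical_deviation_le (D : set 'rV[R]_d) n w h : (0 < n)%N -> H h ->
  `|risk D Pdata h - \sum_t p t * h (rep t)| <= c ->
  `|n%:R^-1 * \sum_(i < n) h (z i w) - risk D Pdata h| <=
  n%:R^-1 * centered_sup p discretized (sample_labels z label n w) + 2 * c.
Proof.
move=> n0 Hh riskc; have nR0 : 0 < n%:R :> R by rewrite ltr0n.
set f := sample_labels z label n w; set ph := \sum_t p t * h (rep t).
have dev := @centered_sup_ub _ f (h \o rep) (ex_intro2 _ _ _ Hh erefl).
have -> : n%:R^-1 * \sum_(i < n) h (z i w) - risk D Pdata h =
    n%:R^-1 * (\sum_(i < n) ((h \o rep) (f i) - ph)
      + \sum_(i < n) (h (z i w) - h (rep (f i)))) - (risk D Pdata h - ph).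
  rewrite -big_split/=; under [in RHS]eq_bigr do rewrite addrC addrA subrK.
  rewrite sumrB sumr_const card_ord mulrBr -[ph *+ n]mulr_natl.
  by rewrite mulKf ?gt_eqF// opprB addrA subrK.
have ninv : 0 <= n%:R^-1 :> R by rewrite invr_ge0 ltW.
rewrite mulrDr; apply: le_trans (ler_normB _ _) _.
rewrite mulr2n mulrDl mul1r addrA lerD//.
apply: le_trans (ler_normD _ _) _; rewrite !normrM (ger0_norm ninv).
rewrite lerD//; first by rewrite ler_wpM2l.
rewrite ler_pdivrMl//; apply: le_trans (ler_norm_sum _ _ _) _.
rewrite mulr_natl -[X in _ *+ X](card_ord n) -sumr_const.
by apply: ler_sum => i _; rewrite ffunE; exact: H_rep.
Qed.

Let signed_avg n (f : {ffun 'I_n -> T}) : R :=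
  (2 ^+ n)^-1 * \sum_(s : {ffun 'I_n -> bool}) signed_sup discretized s f.

Let rad_integrand n (w : Omega) : R :=
  (2 ^+ n)^-1 * \sum_(s : {ffun 'I_n -> bool})
    (n%:R^-1 * sup [set `|\sum_(i < n) (-1) ^+ s i * h (z i w)| | h in H]).

Let signed_sample_le n (s : {ffun 'I_n -> bool}) w h : H h ->
  `|\sum_(i < n) (-1) ^+ s i * h (z i w)| <= n%:R * B.
Proof.
move=> Hh; apply: le_trans (ler_norm_sum _ _ _) _.
rewrite mulr_natl -[X in _ *+ X](card_ord n) -sumr_const.
apply: ler_sum => i _.
by rewrite normrM normrX normrN1 expr1n mul1r H_le.
Qed.

Let avg_le n (F : {ffun 'I_n -> bool} -> R) (a : R) :
  (forall s, F s <= a) -> (2 ^+ n)^-1 * \sum_s F s <= a.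
Proof.
move=> Fa; rewrite ler_pdivrMl ?exprn_gt0//.
rewrite (_ : 2 ^+ n = #|{ffun 'I_n -> bool}|%:R); last first.
  by rewrite card_ffun card_bool card_ord natrX.
by rewrite mulr_natl -sumr_const; exact: ler_sum.
Qed.

Let signed_avg_le n w : (0 < n)%N ->
  n%:R^-1 * signed_avg (sample_labels z label n w) - c <= rad_integrand n w.
Proof.
move=> n0; have nR0 : 0 < n%:R :> R by rewrite ltr0n.
set f := sample_labels z label n w.
rewrite lerBlDl -lerBlDr /signed_avg /rad_integrand mulrCA -mulrBr mulr_sumr.
rewrite -sumrB; apply: avg_le => s.
rewrite -mulrBr ler_pdivrMl// lerBlDl.
apply: sup_abs_le; first exact: discretized_neq0.
move=> _ [h Hh <-]; rewrite [leRHS]addrC.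
have -> : \sum_i (-1) ^+ s i * (h \o rep) (f i) =
    \sum_(i < n) (-1) ^+ s i * h (z i w) -
    \sum_(i < n) (-1) ^+ s i * (h (z i w) - h (rep (f i))).
  by rewrite -sumrB; apply: eq_bigr => i _; rewrite -mulrBr subKr.
apply: le_trans (ler_normB _ _) _; rewrite [leRHS]addrC; apply: lerD.
  by apply: (le_sup_abs _ Hh) => h' Hh'; exact: signed_sample_le.
apply: le_trans (ler_norm_sum _ _ _) _.
rewrite mulr_natl -[X in _ *+ X](card_ord n) -sumr_const.
apply: ler_sum => i _.
by rewrite normrM normrX normrN1 expr1n mul1r ffunE H_rep.
Qed.

Let sum_signed_avg_le n : (0 < n)%N ->
  \sum_(f : {ffun 'I_n -> T}) prod_weight p f * signed_avg f <=
  n%:R * (rademacher P z H n + c).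
Proof.
move=> n0; have nR0 : 0 < n%:R :> R by rewrite ltr0n.
pose G (f : {ffun 'I_n -> T}) := Num.max 0 (n%:R^-1 * signed_avg f - c).
have B_ge0 : 0 <= B.
  have [h Hh] := H_neq0; have [w _] : [set: Omega] !=set0.
    apply/set0P/negP => /eqP PT; have := probability_setT P.
    by rewrite PT measure0 => /eqP; rewrite eqe eq_sym oner_eq0.
  exact: le_trans (normr_ge0 _) (H_le Hh (z_in 0%N w)).
have sup_ge0 (s : {ffun 'I_n -> bool}) w :
    0 <= sup [set `|\sum_(i < n) (-1) ^+ s i * h (z i w)| | h in H].
  apply: (@sup_abs_ge0 _ _ H _ (n%:R * B)) => // h Hh.
  exact: signed_sample_le.
(* The integrand of [rademacher] need not be known to be measurable, so that
   its integral is only compared with that of the smaller simple function [G]. *)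
have G_le : \int[P]_w G (sample_labels z label n w) <= rademacher P z H n.
  apply: (@le_Rintegral_nonmeas _ _ _ _ _ _ _ B) => //.
  - exact: probability_le1.
  - by move=> w _; rewrite le_max lexx.
  - move=> w _; rewrite ge_max signed_avg_le// andbT.
    rewrite mulr_ge0 ?invr_ge0 ?exprn_ge0// sumr_ge0// => s _.
    by rewrite mulr_ge0// invr_ge0 ltW.
  - move=> w _; apply: avg_le => s; rewrite ler_pdivrMl//.
    apply: sup_abs_le => // h Hh; exact: signed_sample_le.
rewrite (integral_sample_labels z_iid mlabel) in G_le.
rewrite -ler_pdivrMl// mulr_sumr -lerBlDr; apply: le_trans G_le.
have cE : c = \sum_(f : {ffun 'I_n -> T}) prod_weight p f * c.
  by rewrite -mulr_suml sum_prod_weight// mul1r.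
rewrite [X in _ - X]cE -sumrB; apply: ler_sum => f _; rewrite mulrCA -mulrBr.
by rewrite ler_wpM2l ?prod_weight_ge0// /G le_max lexx orbT.
Qed.

Lemma centered_sup_tail n (a : R) : (0 < n)%N -> 0 < a ->
  (P [set w | (a < centered_sup p discretized (sample_labels z label n w))%R] <=
   (2 * n%:R * (rademacher P z H n + c) / a)%:E)%E.
Proof.
move=> n0 a0; apply: le_trans.
  by apply: (sample_labels_markov z_iid mlabel) a0 => f; exact: centered_sup_ge0.
rewrite lee_fin ler_pM2r ?invr_gt0// -mulrA.
apply: le_trans (symmetrization n p_ge0 p_sum1 discretized_neq0 discretized_le) _.
by rewrite ler_pM2l//; exact: sum_signed_avg_le.
Qed.

End Deviation.

Theorem theorem6 (R : realType) (d : nat) (N : 'rV[R]_d -> R)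
  (hN : is_norm N)
  (Z : set 'rV[R]_d) (Zopen : open Z) (Zbounded : bounded_set Z)
  (* the data distribution, carried by Z, and the sample z 0, z 1, ... *)
  (Pdata : probability (borel_rV R d) R)
  (PdataZ : Pdata (Z : set (borel_rV R d)) = 1%E)
  (dO : measure_display) (Omega : measurableType dO) (P : probability Omega R)
  (z : nat -> Omega -> borel_rV R d)
  (z_iid : iid P Pdata z) (z_in : forall i w, Z (z i w))
  (alpha beta : nat -> R)
  (alpha_gt0 : forall n, 0 < alpha n) (beta_gt0 : forall n, 0 < beta n)
  (alpha_cvg : alpha @ \oo --> (0 : R)) (beta_cvg : beta @ \oo --> (0 : R))
  (P' : nat -> Omega -> {measure set (borel_rV R d) -> \bar R})
  (P'_perturbed : forall n w, (0 < n)%N ->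
     locally_perturbed N n (fun i => z i w) (beta n) (P' n w))
  (CH Cgrad L k M : R)
  (CH_gt0 : 0 < CH) (Cgrad_gt0 : 0 < Cgrad) (L_gt0 : 0 < L)
  (k_gt0 : 0 < k) (k_le1 : k <= 1)
  (M_ge : (ereal_sup (range (EFin \o beta)) <= M%:E)%E)
  (H : set ('rV[R]_d -> R)) :
  let D := enlarge N (convex_hull Z) M in
  (exists B : R, forall h, H h -> forall x, D x -> `|h x| <= B) ->
  (forall h, H h ->
     [/\ forall x, D x -> differentiable h x,
         holder N D CH k (grad h),
         Cgrad <= \int[Pdata]_(x in (D : set (borel_rV R d)))
                    dual_norm N (grad h x)
       & (Lip N D h <= L%:E)%E]) ->
  forall p : R, 1 + k < p ->
  forall hhat : nat -> Omega -> ('rV[R]_d -> R),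
  (forall n w, (0 < n)%N ->
     is_minimizer (prop_objective N D (P' n w) (alpha n) p) H (hhat n w)) ->
  bigOp P (fun n w => excess_risk D Pdata H (hhat n w))
    (fun n => Num.max (rademacher P z H n)
             (Num.max (n%:R `^ (- 2^-1))
             (Num.max (alpha n)
                (ln n%:R * Num.max (alpha n `^ (1 + k)) (beta n))))).
Proof.
move=> D [B H_le] H_prop p p_gt hhat hhat_min eps eps_gt0.
pose K := L + 1.
have K_gt0 : 0 < K by rewrite addr_gt0.
have D_open : open D by exact: open_enlarge_hull.
have mD := open_borel D_open.
have mZ := open_borel Zopen.
have beta_le n : beta n <= M.
  rewrite -lee_fin; apply: le_trans M_ge; apply: ereal_sup_ubound.
  by exists n.
have ZD : Z `<=` D.
  move=> x Zx; rewrite -[x]addr0; apply: enlarge_hull => //.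
  by rewrite is_norm0// (le_trans (ltW (beta_gt0 0%N))).
have [w0 _] : [set: Omega] !=set0.
  apply/set0P/negP => /eqP PT; have := probability_setT P.
  by rewrite PT measure0 => /eqP; rewrite eqe eq_sym oner_eq0.
have H_neq0 : H !=set0 by exists (hhat 1%N w0); have [] := hhat_min 1%N w0.
have h_lip h : H h -> forall x y, D x -> D y -> `|h x - h y| <= K * N (x - y).
  by move=> /H_prop[_ _ _]; exact: Lip_le_succ.
have h_diff h : H h -> forall x, D x -> differentiable h x.
  by move=> /H_prop[].
have mh h : H h ->
    measurable_fun (D : set (borel_rV R d)) (h : borel_rV R d -> R).
  move=> Hh; apply: continuous_borel => // x /set_mem Dx.
  by apply: differentiable_continuous; exact: h_diff.
pose C := 7 * K + 8 * (1 + K) / eps.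
have [n0 n0P] : exists n0, forall n, (n0 <= n)%N ->
    (0 < n)%N /\ 1 <= ln (n%:R : R).
  exists (Num.trunc (expR (1 : R))).+1 => n le_n.
  have n_gt0 := leq_trans (ltn0Sn _) le_n.
  split=> //; rewrite -[leLHS]expRK ler_ln ?posrE ?expR_gt0 ?ltr0n//.
  by rewrite (le_trans (ltW (truncnS_gt _)))// ler_nat.
exists C, n0 => n /n0P[n_gt0 ln_ge1].
set a := Num.max _ _.
have nR_gt0 : 0 < n%:R :> R by rewrite ltr0n.
have rad_le : rademacher P z H n <= a by rewrite /a le_max lexx.
have alpha_le : alpha n <= a by rewrite /a !le_max lexx !orbT.
have beta_le_a : beta n <= a.
  rewrite /a !le_max; apply/orP; right; apply/orP; right; apply/orP; right.
  apply: (@le_trans _ _ (Num.max (alpha n `^ (1 + k)) (beta n))).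
    by rewrite le_max lexx orbT.
  by rewrite ler_peMl// le_max (ltW (beta_gt0 n)) orbT.
have a_gt0 : 0 < a by exact: lt_le_trans alpha_le.
have beta_n_gt0 := beta_gt0 n.
have [T [label [rep [mlabel Z_rep rep_near]]]] :=
  discretization hN Zbounded (z_in 0%N w0) beta_n_gt0.
have Kb_ge0 : 0 <= K * beta n by rewrite mulr_ge0 ?ltW.
have H_rep h : H h -> forall x, Z x -> `|h x - h (rep (label x))| <= K * beta n.
  move=> Hh x Zx; apply: le_trans (h_lip _ Hh _ _ (ZD _ Zx) (ZD _ (Z_rep _))) _.
  by rewrite ler_pM2l// rep_near.
have H_leZ h : H h -> forall x, Z x -> `|h x| <= B.
  by move=> Hh x Zx; apply: H_le => //; exact: ZD.
have risk_le h : H h ->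
    `|risk D Pdata h - \sum_t label_prob Pdata label t * h (rep t)| <=
    K * beta n.
  move=> Hh; apply: (risk_label_prob PdataZ mD mZ ZD Kb_ge0 mlabel (mh _ Hh)).
    exact: H_le.
  exact: H_rep.
pose G w := centered_sup (label_prob Pdata label) (discretized H rep)
  (sample_labels z label n w).
have excess_le w : `|excess_risk D Pdata H (hhat n w)| <=
    2 * (n%:R^-1 * G w) + 7 * K * a.
  have [e [e_le QE]] := P'_perturbed n w n_gt0.
  have De i : (i < n)%N -> D (z i w + e i).
    move=> /e_le ei; apply: enlarge_hull => //.
    exact: le_trans ei (beta_le n).
  have QD : P' n w (D : set (borel_rV R d)) = 1%E.
    by rewrite QE// empirical_full.
  have p_gt1 : 1 < p by apply: lt_trans p_gt; rewrite ltrDl.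
  have := @excess_risk_bound R d N D Pdata (P' n w) H (alpha n) p K
    (K * beta n + (n%:R^-1 * G w + 2 * (K * beta n))) (hhat n w)
    (ltW (alpha_gt0 n)) (hhat_min n w n_gt0).
  move=> /(_ _ _)/le_trans; apply.
  - move=> h Hh; rewrite (risk_empirical n_gt0 De QE mD (mh _ Hh) (H_le _ Hh)).
    rewrite -[X in `|X - _|](subrK (n%:R^-1 * \sum_(i < n) h (z i w))) -addrA.
    apply: le_trans (ler_normD _ _) _; apply: lerD; last first.
      exact: (empirical_deviation_le z_in H_leZ mlabel Z_rep H_rep w n_gt0 Hh
        (risk_le _ Hh)).
    rewrite -mulrBr -sumrB normrM ger0_norm ?invr_ge0 ?(ltW nR_gt0)//.
    rewrite ler_pdivrMl//; apply: le_trans (ler_norm_sum _ _ _) _.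
    rewrite mulr_natl -[X in _ *+ X](card_ord n) -sumr_const.
    apply: ler_sum => i _.
    apply: le_trans (h_lip _ Hh _ _ (De _ (ltn_ord i)) _) _.
      by apply: ZD; exact: z_in.
    by rewrite addrAC subrr add0r ler_pM2l// e_le.
  - move=> h Hh; apply: norm_Lr_le => //; first by rewrite QD.
    - by rewrite invr_gt0 subr_gt0 invf_lt1// (lt_trans _ p_gt1).
    - exact: ltW.
    - move=> x Dx; have hl := h_lip _ Hh; have hd := h_diff _ Hh.
      by rewrite (dual_norm_grad_ge0 hN D_open (ltW K_gt0) hl hd Dx)
        (dual_norm_grad_le hN D_open (ltW K_gt0) hl hd Dx).
  have := ler_wpM2l (ltW K_gt0) beta_le_a.
  have := ler_wpM2r (ltW K_gt0) alpha_le.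
  move: (n%:R^-1 * G w) => g; move: (a) (alpha n) (beta n) => a' an bn.
  by rewrite [a' * K]mulrC -!mulrA; lra.
pose tau := n%:R * (4 * (1 + K) / eps * a).
have K1_gt0 : 0 < 1 + K by rewrite addr_gt0.
have tau_gt0 : 0 < tau by rewrite !mulr_gt0 ?invr_gt0.
apply: (@le_lt_trans _ _ (P [set w | (tau < G w)%R])).
  rewrite -measurable_mu_extE; last first.
    exact: (measurable_finite_valued
      (measurable_sample_labels z_iid mlabel (n := n))
      [set f | tau < centered_sup (label_prob Pdata label)
                       (discretized H rep) f]).
  apply: le_mu_ext => w /= /lt_le_trans/(_ (excess_le w)).
  rewrite /C mulrDl addrC ltrD2r => lt_G.
  rewrite /tau -ltr_pdivlMl//; move: lt_G; move: (n%:R^-1 * G w) => g.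
  move=> lt_G; rewrite -(ltr_pM2l (ltr0Sn R 1)).
  by apply: le_lt_trans lt_G; rewrite !mulrA -natrM.
apply: le_lt_trans (centered_sup_tail z_iid z_in H_neq0 H_leZ mlabel Z_rep
  H_rep n_gt0 tau_gt0) _.
rewrite lte_fin ltr_pdivrMr//.
apply: (@le_lt_trans _ _ (2 * n%:R * ((1 + K) * a))).
  rewrite ler_pM2l ?mulr_gt0// [leRHS]mulrDl mul1r lerD// ler_pM2l//.
rewrite /tau.
have -> : eps * (n%:R * (4 * (1 + K) / eps * a)) =
    2 * (2 * n%:R * ((1 + K) * a)).
  by field; rewrite gt_eqF.
by rewrite ltr_pMl ?ltr1n// !mulr_gt0.
Qed.
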